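(* Let $L \in \mathbb{R}^{n\times n}$ be symmetric positive definite, let $K := L^{-1}$, let $V \in \mathbb{R}^{n\times k}$ have orthonormal columns, let $t>0$, and define $P(t) := e^{-Lt}$ and $\tilde P(t) := V e^{-(V^\top L V)t} V^\top$. Put $$\nu_2 := \|K - V(V^\top L V)^{-1}V^\top\|_2,\qquad \nu_* := \|K - V(V^\top L V)^{-1}V^\top\|_* .$$ Then $$\|P(t)-\tilde P(t)\|_2 \le \frac{3\sqrt3}{2\pi}\,\frac{\nu_2}{t}\qquad\text{and}\qquad \|P(t)-\tilde P(t)\|_* \le \frac{3\sqrt3}{2\pi}\,\frac{\nu_*}{t}.$$
   Context: $\|\cdot\|_2$ is the spectral norm (largest singular value) and $\|\cdot\|_*$ the nuclear norm (sum of singular values). *)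

(* Defs.v *)
From HB Require Import structures.
From mathcomp Require Import all_boot all_order all_algebra.
From mathcomp Require Import polyrcf.
From mathcomp Require Import all_classical all_reals all_analysis.

Set Implicit Arguments.
Unset Strict Implicit.
Unset Printing Implicit Defensive.

Import Order.TTheory GRing.Theory Num.Theory.
Import numFieldNormedType.Exports.

Local Open Scope classical_set_scope.
Local Open Scope ring_scope.

Definition posdefmx (R : realType) (n : nat) (A : 'M[R]_n) : Prop :=
  A \is symmetricmx /\
  forall x : 'cV[R]_n, x != 0 -> 0 < (x^T *m A *m x) 0 0.

(* The limit is taken in the product topology of the entries, i.e. the norm
   topology of 'M[R]_n; the series converges for every A. *)
Definition expmx (R : realType) (n : nat) (A : 'M[R]_n) : 'M[R]_n :=
  limn (series (fun k : nat => (k`!%:R)^-1 *: A ^+ k)).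

(* Square roots of the eigenvalues of A^T A, each repeated according to its
   multiplicity as a root of the characteristic polynomial ([rootsR] lists the
   real roots without repetition, and A^T A has only real, nonnegative
   eigenvalues). The list thus has n entries, zeros included. *)
Definition singular_values (R : realType) (m n : nat) (A : 'M[R]_(m, n)) :
    seq R :=
  let p := char_poly (A^T *m A) in
  flatten [seq nseq (mup x p) (Num.sqrt x) | x <- rootsR p].

(* The default value 0 of the maximum only matters when n = 0. *)
Definition spectral_norm (R : realType) (m n : nat) (A : 'M[R]_(m, n)) : R :=
  \big[Num.max/0]_(s <- singular_values A) s.

Definition nuclear_norm (R : realType) (m n : nat) (A : 'M[R]_(m, n)) : R :=
  \sum_(s <- singular_values A) s.

(* Main.v *)
Require Import Defs.
From HB Require Import structures.
From mathcomp Require Import all_boot all_order all_algebra.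
From mathcomp Require Import polyrcf spectral complex ring lra.
From mathcomp Require Import all_classical all_reals all_analysis.

Set Implicit Arguments.
Unset Strict Implicit.
Unset Printing Implicit Defensive.

Import Order.TTheory GRing.Theory Num.Theory.
Import numFieldNormedType.Exports.

Local Open Scope classical_set_scope.
Local Open Scope ring_scope.

(* For a > 0, e^(-ta) is a contour integral of e^(tz) / (z + a) over the two
   rays z = r e^(+-i theta). With A := V (V^T L V)^-1 V^T, the resolvent difference
   factors as
     (z + L)^-1 - V (z + V^T L V)^-1 V^T = (1 + zK)^-1 (K - A) (1 + zA)^-1,
   where both outer factors have norm at most 1 / sin theta. Integrating
   e^(-rt |cos theta|) gives the constant 1 / (pi |cos theta| sin^2 theta), which
   is smallest for |cos theta| = 1 / sqrt 3. In eigenbases of K - A and of the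
   difference of exponentials, the diagonal entries of the product are
   combinations of the eigenvalues of K - A whose weights have row and column
   sums at most 1 / sin^2 theta; this gives both norms at once.

   No integral is needed: e^(tz) is replaced by (1 - tz/m)^-m, whose product with
   1 / (z + a) has an explicit primitive along the ray (two arctangents plus a
   rational function), so that the bound follows by comparing derivatives; then
   m tends to infinity. *)

Local Notation Re := complex.Re.
Local Notation Im := complex.Im.
Local Notation "x %:C" := (real_complex_def (Phant _) x) : ring_scope.

Local Notation toC := (map_mx (real_complex _)).

Import complex.ComplexField.Normc.

(** * Complex-valued functions of a real variable *)

Lemma ImD (R : rcfType) (z w : R[i]) : Im (z + w) = Im z + Im w.
Proof. by case: z w => [? ?] [? ?]. Qed.

Lemma Im_realM (R : rcfType) (x : R) (z : R[i]) : Im (x%:C * z) = x * Im z.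
Proof. by case: z => u v /=; rewrite mul0r addr0. Qed.

Lemma normc_ge0 (R : rcfType) (z : R[i]) : 0 <= normc z.
Proof. by case: z => u v; exact: sqrtr_ge0. Qed.

Lemma normc_real (R : rcfType) (x : R) : normc x%:C = `|x|.
Proof. by rewrite /= expr0n /= addr0 sqrtr_sqr. Qed.

Lemma normr_Im_le (R : rcfType) (z : R[i]) : `|Im z| <= normc z.
Proof.
by case: z => u v /=; rewrite -sqrtr_sqr; apply: ler_wsqrtr; rewrite lerDr sqr_ge0.
Qed.

Lemma normcX (R : rcfType) (z : R[i]) n : normc (z ^+ n) = normc z ^+ n.
Proof.
elim: n => [|n IH]; first by rewrite !expr0 normc1.
by rewrite !exprS normcM IH.
Qed.

Lemma normc_sum (R : rcfType) (I : Type) (rs : seq I) (F : I -> R[i]) :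
  normc (\sum_(i <- rs) F i) <= \sum_(i <- rs) normc (F i).
Proof.
elim: rs => [|i rs IH]; first by rewrite !big_nil normc0.
rewrite !big_cons; apply: le_trans (le_normcD _ _) _.
by rewrite lerD2l.
Qed.

Lemma sqr_normcE (R : rcfType) (z : R[i]) : (normc z ^+ 2)%:C = conjc z * z.
Proof.
case: z => u v /=; rewrite sqr_sqrtr ?addr_ge0 ?sqr_ge0 //.
by apply/eqP; rewrite eq_complex /=; apply/andP; split; apply/eqP; ring.
Qed.

(** Componentwise, so that differentiation along a ray reduces to real functions of a real
    variable. *)
Definition is_cderive (R : realType) (F : R -> R[i]) (x : R) (d : R[i]) :=
  is_derive x 1 (fun y => Re (F y)) (Re d) /\
  is_derive x 1 (fun y => Im (F y)) (Im d).

Lemma is_cderiveM (R : realType) (F G : R -> R[i]) x d e :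
  is_cderive F x d -> is_cderive G x e ->
  is_cderive (fun y => F y * G y) x (d * G x + F x * e).
Proof.
move=> [F1 F2] [G1 G2]; split.
- rewrite (_ : (fun y => _) =
    (fun y => Re (F y)) * (fun y => Re (G y)) - (fun y => Im (F y)) * (fun y => Im (G y))).
    apply: (is_derive_eq (is_deriveB (is_deriveM F1 G1) (is_deriveM F2 G2))).
    rewrite /GRing.scale /=.
    by case: (F x) (G x) d e {F1 F2 G1 G2} => [? ?] [? ?] [? ?] [? ?] /=; ring.
  by apply/funext => y; rewrite !fctE; case: (F y) (G y) => [? ?] [? ?].
- rewrite (_ : (fun y => _) =
    (fun y => Re (F y)) * (fun y => Im (G y)) + (fun y => Im (F y)) * (fun y => Re (G y))).
    apply: (is_derive_eq (is_deriveD (is_deriveM F1 G2) (is_deriveM F2 G1))).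
    rewrite /GRing.scale /=.
    by case: (F x) (G x) d e {F1 F2 G1 G2} => [? ?] [? ?] [? ?] [? ?] /=; ring.
  by apply/funext => y; rewrite !fctE; case: (F y) (G y) => [? ?] [? ?].
Qed.

Lemma is_cderiveX (R : realType) (F : R -> R[i]) x d n :
  is_cderive F x d -> is_cderive (fun y => F y ^+ n.+1) x (n.+1%:R * F x ^+ n * d).
Proof.
move=> Fd; elim: n => [|n IH].
  rewrite expr0 !mul1r; by under [X in is_cderive X]funext do rewrite expr1.
under [X in is_cderive X]funext do rewrite exprS.
have := is_cderiveM Fd IH; congr is_cderive.
by rewrite -(natr1 n.+1) [F x ^+ n.+1]exprS; ring.
Qed.

Lemma is_cderiveV (R : realType) (F : R -> R[i]) x d :
  F x != 0 -> is_cderive F x d ->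
  is_cderive (fun y => (F y)^-1) x (- d * (F x)^-1 ^+ 2).
Proof.
move=> F0 [F1 F2].
(* The squared modulus: 1 / F is the conjugate of F divided by [N]. *)
pose N := fun y => (Re (F y)) ^+ 2 + (Im (F y)) ^+ 2.
have N0 : N x != 0.
  apply: contra F0 => /eqP; rewrite /N; case: (F x) => a b /= ab.
  have /eqP := ab; rewrite paddr_eq0 ?sqr_ge0 // !sqrf_eq0 => /andP[/eqP-> /eqP->].
  by [].
have Nd : is_derive x 1 N (2 * Re (F x) * Re d + 2 * Im (F x) * Im d).
  rewrite (_ : N = (fun y => Re (F y)) * (fun y => Re (F y)) +
      (fun y => Im (F y)) * (fun y => Im (F y))).
    apply: (is_derive_eq (is_deriveD (is_deriveM F1 F1) (is_deriveM F2 F2))).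
    by rewrite /GRing.scale /=; ring.
  by apply/funext => y; rewrite !fctE /N !expr2.
have Nv := is_deriveV N0 Nd.
have N0' : (Re (F x)) ^+ 2 + (Im (F x)) ^+ 2 != 0 by [].
split.
- rewrite (_ : (fun y => _) = (fun y => Re (F y)) * (fun y => (N y)^-1)).
    apply: (is_derive_eq (is_deriveM F1 Nv)); rewrite /GRing.scale /= /N.
    move: N0'; case: (F x) d {F0 F1 F2 N0 Nd Nv} => [a b] [u v] /= N0'.
    by field.
  by apply/funext => y; rewrite !fctE /N; case: (F y) => [? ?].
- rewrite (_ : (fun y => _) = - ((fun y => Im (F y)) * (fun y => (N y)^-1))).
    apply: (is_derive_eq (is_deriveN (is_deriveM F2 Nv))); rewrite /GRing.scale /= /N.
    move: N0'; case: (F x) d {F0 F1 F2 N0 Nd Nv} => [a b] [u v] /= N0'.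
    by field.
  by apply/funext => y; rewrite !fctE /N; case: (F y) => [? ?].
Qed.

(** * Primitives of rational approximations along a ray *)

Lemma is_derive_atan_affine (R : realType) (u v r : R) :
  is_derive r 1 (fun x => atan (u * x + v)) (u / (1 + (u * r + v) ^+ 2)).
Proof.
have H : is_derive r 1 (fun x : R => u * x + v) u.
  rewrite (_ : (fun x => _) = u \*: (@id R) + cst v); last exact/funext.
  by apply: is_derive_eq; rewrite /GRing.scale /= mulr1 addr0.
have Ha := @is_derive1_atan R (u * r + v).
have := @is_derive1_comp R (@atan R) (fun x => u * x + v) r _ _ Ha H.
by rewrite mulrC.
Qed.

Lemma cvgy_affine (R : realType) (u v : R) :
  0 < u -> (u * x + v) @[x --> +oo] --> +oo.
Proof.
move=> u0; apply/cvgryPge => A; near=> x.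
rewrite -lerBlDr -ler_pdivrMl //; near: x; exact: nbhs_pinfty_ge.
Unshelve. all: by end_near. Qed.

Lemma cvgy_atan_affine (R : realType) (u v : R) :
  0 < u -> atan (u * x + v) @[x --> +oo] --> pi / 2.
Proof. by move=> u0; apply: cvg_comp (cvgy_affine v u0) (@cvgy_atan R). Qed.

Section ray.
Variables (R : realType) (c s : R).
Hypotheses (c_gt0 : 0 < c) (s_gt0 : 0 < s) (cs1 : c ^+ 2 + s ^+ 2 = 1).

(** The direction e^(i theta) of the upper ray, with [c] = |cos theta| and [s] = sin theta; it
    points into the left half-plane. *)
Local Notation e := (Complex (- c) s).

Lemma ray_plus_neq0 (a r : R) : 0 < a -> e * r%:C + a%:C != 0.
Proof.
move=> a0; rewrite eq_complex /= !(mulr0, subr0, add0r, addr0) mulf_eq0.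
rewrite (gt_eqF s_gt0) /=; apply/negP => /andP[/[swap] /eqP->].
by rewrite mulr0 add0r (gt_eqF a0).
Qed.

Lemma one_minus_ray_neq0 (tau r : R) : 0 < tau -> 1 - tau%:C * e * r%:C != 0.
Proof.
move=> tau0; rewrite eq_complex /=.
rewrite !(mul0r, mulr0, subr0, add0r, addr0, oppr_eq0) !mulf_eq0.
rewrite (gt_eqF s_gt0) (gt_eqF tau0) /=; apply/negP => /andP[/[swap] /eqP->].
by rewrite mulr0 subr0 oner_eq0.
Qed.

Lemma Im_ray_plus (a r : R) : 0 < a ->
  Im (e / (e * r%:C + a%:C)) = a * s / (a ^+ 2 - 2 * a * c * r + r ^+ 2).
Proof.
move=> a0; rewrite /= !(mulr0, subr0, add0r, addr0).
have -> : (- c * r + a) ^+ 2 + (s * r) ^+ 2 =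
    a ^+ 2 - 2 * a * c * r + (c ^+ 2 + s ^+ 2) * r ^+ 2 by ring.
by rewrite cs1 mul1r; ring.
Qed.

Lemma Im_one_minus_ray (tau r : R) : 0 < tau ->
  Im (tau%:C * e * (1 - tau%:C * e * r%:C)^-1) =
  tau * s / (1 + 2 * tau * c * r + (tau * r) ^+ 2).
Proof.
move=> a0; rewrite /= !(mul0r, mulr0, subr0, add0r, addr0).
have -> : (1 - tau * - c * r) ^+ 2 + (- (tau * s * r)) ^+ 2 =
    1 + 2 * tau * c * r + (c ^+ 2 + s ^+ 2) * (tau * r) ^+ 2 by ring.
by rewrite cs1 mul1r; ring.
Qed.

Lemma is_cderive_one_minus_ray (tau r : R) : 0 < tau ->
  is_cderive (fun x => (1 - tau%:C * e * x%:C)^-1) r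
    (tau%:C * e * (1 - tau%:C * e * r%:C)^-1 ^+ 2).
Proof.
move=> tau0; have := one_minus_ray_neq0 r tau0.
have D : is_cderive (fun x => 1 - tau%:C * e * x%:C) r (- (tau%:C * e)).
  split => /=.
  - rewrite (_ : (fun y => _) = cst 1 + (tau * c) \*: (@id R)).
      by apply: is_derive_eq; rewrite /GRing.scale /= add0r mulr1 mul0r subr0 mulrN opprK.
    apply/funext => y; rewrite !fctE /= (_ : _ *: y = tau * c * y) //.
    by ring.
  - rewrite (_ : (fun y => _) = (- (tau * s)) \*: (@id R)).
      by apply: is_derive_eq; rewrite /GRing.scale /= mulr1 mul0r addr0.
    apply/funext => y; rewrite [RHS](_ : _ = - (tau * s) * y) //.
    by ring.
move=> N0; have := @is_cderiveV _ (fun x => 1 - tau%:C * e * x%:C) _ _ N0 D.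
by rewrite opprK.
Qed.

(** Partial fractions in z = e r, with poles -a and 1 / tau. *)
Lemma resolvent_split (tau a r : R) : 0 < tau -> 0 < a ->
  (e * r%:C + a%:C)^-1 * (1 - tau%:C * e * r%:C)^-1 =
  ((1 + tau * a)^-1)%:C *
    ((e * r%:C + a%:C)^-1 + tau%:C * (1 - tau%:C * e * r%:C)^-1).
Proof.
move=> tau0 a0.
have := one_minus_ray_neq0 r tau0; have := ray_plus_neq0 r a0.
have H : (1 + tau%:C * a%:C : R[i]) != 0.
  rewrite -rmorphM -(rmorph1 (real_complex R)) -rmorphD /= fmorph_eq0.
  by rewrite gt_eqF // addr_gt0 // mulr_gt0.
have -> : ((1 + tau * a)^-1)%:C = (1 + tau%:C * a%:C : R[i])^-1.
  by rewrite -rmorphM -(rmorph1 (real_complex R)) -rmorphD fmorphV.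
move: H; move: (e) (r%:C) (a%:C) (tau%:C) => e' r' a' t' H0 H1 H2.
by field; rewrite H0 H1 H2.
Qed.

(** The modulus of the denominator is at least its real part 1 + tau c r. This replaces the decay of
    |e^(tz)| along the ray. *)
Lemma normc_one_minus_ray (tau r : R) : 0 < tau -> 0 <= r ->
  normc (1 - tau%:C * e * r%:C)^-1 <= (1 + tau * c * r)^-1.
Proof.
move=> tau0 r0; rewrite normcV.
have P : 0 < 1 + tau * c * r by rewrite ltr_pwDl // !mulr_ge0 // ltW.
have H : 1 + tau * c * r <= normc (1 - tau%:C * e * r%:C).
  rewrite /= !(mul0r, mulr0, subr0, add0r, addr0).
  rewrite -[leLHS](ger0_norm (ltW P)) -sqrtr_sqr; apply: ler_wsqrtr.
  by rewrite mulrN mulNr opprK lerDl sqr_ge0.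
by rewrite lef_pV2 // posrE // (lt_le_trans P).
Qed.

(** Let G = (1 - tau e r)^-1. By induction on the power of G, partial fractions lower the power next
    to 1 / (z + a) and leave a power of G alone, which is integrated directly. The limit stands in
    for the value pi e^(-ta) of the contour integral. *)
Lemma resolvent_primitive (tau a : R) m : 0 < tau -> 0 < a -> exists psi : R -> R,
  [/\ forall r : R, is_derive r 1 psi
        (Im (e * (1 - tau%:C * e * r%:C)^-1 ^+ m.+1 / (e * r%:C + a%:C))),
      psi 0 = 0 &
      psi r @[r --> +oo] --> pi * (1 + tau * a)^-1 ^+ m.+1].
Proof.
move=> tau0 a0; have ta0 : 0 < 1 + tau * a by rewrite addr_gt0 // mulr_gt0.
have split_step p r : e * (1 - tau%:C * e * r%:C)^-1 ^+ p.+1 / (e * r%:C + a%:C) =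
   ((1 + tau * a)^-1)%:C * (e * (1 - tau%:C * e * r%:C)^-1 ^+ p / (e * r%:C + a%:C)
     + tau%:C * e * (1 - tau%:C * e * r%:C)^-1 ^+ p.+1).
  have H := resolvent_split r tau0 a0.
  transitivity (e * (1 - tau%:C * e * r%:C)^-1 ^+ p *
    ((e * r%:C + a%:C)^-1 * (1 - tau%:C * e * r%:C)^-1)).
    by rewrite exprSr; ring.
  by rewrite H exprSr; ring.
elim: m => [|m [psi [dpsi psi0 psiy]]].
(* Base case: [f1] integrates the part from 1 / (z + a), [f2] the part from 1 / (1 - tau z). At 0
   the arguments -c/s and c/s are opposite and the values cancel; at infinity each contributes pi /
   2. *)
- pose k := (1 + tau * a)^-1.
  pose f1 x := atan ((a * s)^-1 * x + (- (c / s))).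
  pose f2 x := atan (tau / s * x + c / s).
  exists (k \*: (f1 + f2)); split.
  + move=> r; rewrite split_step Im_realM expr0 mulr1 expr1.
    rewrite ImD Im_ray_plus // Im_one_minus_ray //.
    have d1 := is_derive_atan_affine (a * s)^-1 (- (c / s)) r.
    have d2 := is_derive_atan_affine (tau / s) (c / s) r.
    rewrite -/f1 in d1; rewrite -/f2 in d2.
    apply: is_derive_eq; rewrite /GRing.scale /= -/k; congr (_ * (_ + _)).
    * have -> : 1 + ((a * s)^-1 * r - c / s) ^+ 2 =
        (a ^+ 2 - 2 * a * c * r + r ^+ 2) / (a * s) ^+ 2.
        transitivity ((a ^+ 2 * (c ^+ 2 + s ^+ 2) - 2 * a * c * r + r ^+ 2) / (a * s) ^+ 2);
          last by rewrite cs1 mulr1.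
        by field; rewrite !gt_eqF.
      by rewrite invf_div mulrA; congr (_ / _); field; rewrite !gt_eqF.
    * have -> : 1 + (tau / s * r + c / s) ^+ 2 =
        (1 + 2 * tau * c * r + (tau * r) ^+ 2) / s ^+ 2.
        transitivity (((c ^+ 2 + s ^+ 2) + 2 * tau * c * r + (tau * r) ^+ 2) / s ^+ 2);
          last by rewrite cs1.
        by field; rewrite !gt_eqF.
      by rewrite invf_div mulrA; congr (_ / _); field; rewrite !gt_eqF.
  + by rewrite [LHS](_ : _ = k * (f1 0 + f2 0)) // /f1 /f2 !mulr0 !add0r atanN addNr mulr0.
  + rewrite expr1 [_ * _]mulrC [X in _ * X](splitr pi).
    apply: cvgZr; apply: cvgD; apply: cvgy_atan_affine.
      by rewrite invr_gt0 mulr_gt0.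
    by rewrite divr_gt0.
(* The extra term tau e G^(m+2) is the derivative of G^(m+1) / (m+1). The imaginary part of that
   primitive vanishes at 0, where G = 1, and at infinity, so the limit only gains the factor [k]. *)
- pose k := (1 + tau * a)^-1.
  pose f x := Im ((1 - tau%:C * e * x%:C)^-1 ^+ m.+1).
  exists (k \*: (psi + (m.+1%:R)^-1 \*: f)); split.
  + move=> r; have [_ df] := is_cderiveX m (is_cderive_one_minus_ray r tau0).
    rewrite -/f in df; have dp := dpsi r.
    apply: is_derive_eq; rewrite [in RHS]split_step [RHS]Im_realM -/k; congr (_ * _).
    rewrite ImD; congr (_ + _); rewrite -[LHS]/(m.+1%:R^-1 * _) -Im_realM; congr Im.
    rewrite fmorphV rmorph_nat /=.
    have : (m.+1%:R : R[i]) != 0 by rewrite pnatr_eq0.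
    move: (1 - _)^-1 => G; move: (m.+1%:R) => N N0.
    rewrite expr2 [G ^+ m.+2]exprS [G ^+ m.+1]exprS; move: (G ^+ m) => g.
    by field.
  + rewrite [LHS](_ : _ = k * (psi 0 + m.+1%:R^-1 * f 0)) // psi0 add0r /f.
    by rewrite mulr0 subr0 invr1 expr1n !mulr0.
  + rewrite exprS mulrCA -[pi * _ ^+ m.+1]addr0.
    have f0 : `|f x| @[x --> +oo] --> (0 : R); last first.
      apply: cvgZr; apply: cvgD => //.
      rewrite -(mulr0 (m.+1%:R^-1)); apply: cvgZr.
      exact: (@norm_cvg0 R R^o).
    apply: (@squeeze_cvgr _ _ _ _ (cst 0) (fun x => (1 + tau * c * x)^-1)).
    * near=> x; rewrite /= normr_ge0 /=.
      have x0 : 0 <= x by near: x; exact: nbhs_pinfty_ge.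
      apply: (le_trans (normr_Im_le _)).
      have P : 1 <= 1 + tau * c * x by rewrite lerDl !mulr_ge0 // ltW.
      have := normc_one_minus_ray tau0 x0 => H.
      rewrite normcX exprS; apply: le_trans H.
      rewrite ler_piMr ?exprn_ile1 ?normc_ge0 //.
      by apply: (le_trans (normc_one_minus_ray tau0 x0)); rewrite invf_le1 // (lt_le_trans ltr01).
    * exact: cvg_cst.
    * apply/gtr0_cvgV0.
        near=> x; rewrite ltr_pwDl // !mulr_ge0 // ?ltW //.
      have : (tau * c * x + 1) @[x --> +oo] --> +oo by apply: cvgy_affine; rewrite mulr_gt0.
      by under eq_fun do rewrite addrC.
Unshelve. all: by end_near. Qed.
End ray.

(** * The exponential sum bound *)

Lemma is_derive_bigsum (R : realType) (I : Type) (rs : seq I) (h : I -> R -> R) (dh : I -> R)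
    (x : R) :
  (forall i, is_derive x 1 (h i) (dh i)) ->
  is_derive x 1 (fun y => \sum_(i <- rs) h i y) (\sum_(i <- rs) dh i).
Proof.
move=> hd; elim: rs => [|i rs IH].
  under [X in is_derive _ _ X]funext do rewrite big_nil.
  by rewrite big_nil; exact: is_derive_cst.
under [X in is_derive _ _ X]funext do rewrite big_cons.
rewrite big_cons; exact: is_deriveD.
Qed.

Lemma cvg_bigsum (R : realType) (I T : Type) (F : set_system T) (FF : Filter F) (rs : seq I)
    (h : I -> T -> R) (l : I -> R) :
  (forall i, h i x @[x --> F] --> l i) ->
  (\sum_(i <- rs) h i x) @[x --> F] --> \sum_(i <- rs) l i.
Proof.
move=> hl; elim: rs => [|i rs IH].
  under eq_fun do rewrite big_nil.
  by rewrite big_nil; exact: cvg_cst.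
under eq_fun do rewrite big_cons.
rewrite big_cons; exact: cvgD.
Qed.

Lemma ge0_derive_ge (R : realType) (f df : R -> R) :
  (forall r : R, 0 <= r -> is_derive r 1 f (df r)) ->
  (forall r, 0 <= r -> 0 <= df r) -> forall r, 0 <= r -> f 0 <= f r.
Proof.
move=> fd df0 r r0; apply: (@ger0_derive1_ndecry R f 0) => //.
- by move=> x; rewrite in_itv /= andbT => /ltW x0; have [] := fd x x0.
- move=> x; rewrite in_itv /= andbT => /ltW x0.
  by rewrite derive1E; have [_ ->] := fd x x0; exact: df0.
- apply: derivable_within_continuous => x; rewrite in_itv /= andbT => x0.
  by have [] := fd x x0.
Qed.

(** Squeezed between e^(-x) and e^(-x / (1 + y)), where y = x / (n+2): the bounds come from 1 + u <=
    e^u at u = y and at u = -y / (1 + y). *)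
Lemma cvg_inv_1Dxn_expR (R : realType) (x : R) : 0 <= x ->
  ((1 + x / n.+2%:R)^-1 ^+ n.+2) @[n --> \oo] --> expR (- x).
Proof.
move=> x0.
have h0 : (n.+2%:R^-1 : R) @[n --> \oo] --> (0 : R).
  have := @cvg_harmonic R; rewrite -(cvg_shiftS (harmonic : R^nat)).
  by [].
apply: (@squeeze_cvgr _ _ _ _ (cst (expR (- x)))
    (fun n : nat => expR (- (x / (1 + x * n.+2%:R^-1))))).
- near=> n; rewrite /=; set y := x / n.+2%:R.
  have y0 : 0 <= y by rewrite divr_ge0.
  have y1 : 0 < 1 + y by rewrite ltr_pwDl.
  have xE : x = n.+2%:R * y by rewrite /y mulrCA divff ?mulr1 // pnatr_eq0.
  apply/andP; split.
    rewrite xE -mulrN expRM_natl lerXn2r ?nnegrE ?invr_ge0 ?expR_ge0 ?(ltW y1) //.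
    by rewrite expRN lef_pV2 ?posrE ?expR_gt0 // expR_ge1Dx.
  rewrite [X in expR X](_ : _ = n.+2%:R * - (y / (1 + y))).
    rewrite expRM_natl lerXn2r ?nnegrE ?invr_ge0 ?expR_ge0 ?(ltW y1) //.
    apply: le_trans (expR_ge1Dx _); rewrite le_eqVlt; apply/orP; left; apply/eqP.
    by field; rewrite gt_eqF.
  by rewrite mulrN mulrA -xE.
- exact: cvg_cst.
- apply: (@cvg_comp _ _ _ (fun n : nat => - (x / (1 + x * n.+2%:R^-1))) expR _ (nbhs (- x))).
    have h1 : (1 + x * n.+2%:R^-1) @[n --> \oo] --> (1 + x * 0 : R).
      by apply: cvgD; [exact: cvg_cst|exact: cvgZr].
    rewrite mulr0 addr0 in h1.
    have h2 : (- (x * (1 + x * n.+2%:R^-1)^-1)) @[n --> \oo] --> - (x * 1^-1 : R).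
      by apply: cvgN; apply: cvgZr; apply: cvgV => //; exact: oner_neq0.
    by rewrite invr1 mulr1 in h2.
  exact: continuous_expR.
Unshelve. all: by end_near. Qed.

Section ray_sum.
Variables (R : realType) (c s : R).
Hypotheses (c_gt0 : 0 < c) (s_gt0 : 0 < s) (cs1 : c ^+ 2 + s ^+ 2 = 1).

Local Notation e := (Complex (- c) s).

(** The weights may have either sign; only the whole sum is bounded, which keeps the cancellation
    between the two resolvents. *)
Variables (I : finType) (p a : I -> R) (M : R).
Hypothesis a_gt0 : forall i, 0 < a i.
Hypothesis resolvent_le : forall r : R, 0 <= r ->
  normc (\sum_i (p i)%:C / (e * r%:C + (a i)%:C)) <= M.

(** The combination [Phi] of primitives has derivative at most M (1 + tau c r)^-(m+2) for r >= 0 and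
    tends to pi times the left side. The exponent [m.+2] keeps this majorant integrable for every
    [m]. *)
Lemma rational_sum_le (tau : R) (m : nat) : 0 < tau ->
  \sum_i p i * (1 + tau * a i)^-1 ^+ m.+2 <= M / (pi * (tau * c * m.+1%:R)).
Proof.
move=> tau0.
have [psi psiP] := choice (fun i => resolvent_primitive c_gt0 s_gt0 cs1 m.+1 tau0 (a_gt0 i)).
pose Phi r := \sum_i p i * psi i r.
pose S (r : R) := \sum_i (p i)%:C / (e * r%:C + (a i)%:C).
have M0 : 0 <= M by apply: le_trans (normc_ge0 _) (resolvent_le (lexx 0)).
pose G (r : R) := (1 - tau%:C * e * r%:C)^-1 : R[i].
have dPhi (r : R) : is_derive r 1 Phi (Im (e * G r ^+ m.+2 * S r)).
  have -> : Im (e * G r ^+ m.+2 * S r) =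
      \sum_i p i * Im (e * G r ^+ m.+2 / (e * r%:C + (a i)%:C)).
    rewrite /S mulr_sumr.
    rewrite (big_morph (@complex.Im R) (@ImD R) (erefl : Im 0 = 0)); apply: eq_bigr => i _.
    by rewrite -Im_realM; congr Im; ring.
  apply: is_derive_bigsum => i.
  by have [d _ _] := psiP i; exact: is_deriveZ (d r).
pose k := M / (tau * c * m.+1%:R).
have tc0 : 0 < tau * c by rewrite mulr_gt0.
have den0 r : 0 <= r -> 0 < 1 + tau * c * r.
  by move=> r0; rewrite ltr_pwDl // mulr_ge0 // ltW.
(* A primitive of the majorant that vanishes at infinity; from 0 on it rises by [k] in total. *)
pose B r := - k * (1 + tau * c * r)^-1 ^+ m.+1.
have dB (r : R) : 0 <= r -> is_derive r 1 B (M * (1 + tau * c * r)^-1 ^+ m.+2).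
  move=> r0.
  have d1 : is_derive r 1 (fun x => 1 + tau * c * x) (tau * c).
    rewrite (_ : (fun x => _) = cst 1 + (tau * c) \*: (@id R)); last exact/funext.
    apply: (is_derive_eq (is_deriveD (is_derive_cst _ _ _) (is_deriveZ _ (is_derive_id _ _)))).
    by rewrite /GRing.scale /= mulr1 add0r.
  have N0 := lt0r_neq0 (den0 r r0).
  have d2 := @is_deriveV R _ r _ 1 N0 d1.
  have d3 := @is_deriveZ R _ _ _ (- k) _ _ _ (@is_deriveX R _ _ m.+1 _ _ _ d2).
  have -> : B = - k \*: (fun y : R => (1 + tau * c * y)^-1) ^+ m.+1.
    by apply/funext => y; rewrite /B [in RHS]/= fctE.
  apply: (is_derive_eq d3); rewrite /GRing.scale /= /k.
  rewrite [in RHS]exprS [in RHS]exprS; move: (_ ^-1 ^+ m) => g.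
  have : (m.+1%:R : R) != 0 by rewrite pnatr_eq0.
  move: N0 (lt0r_neq0 c_gt0) (lt0r_neq0 tau0).
  move: (m.+1%:R) => N; move=> h1 h2 h3 h4.
  by field; rewrite h1 h2 h3 h4.
have cmp r : 0 <= r -> Phi r <= k.
  move=> r0.
  have Phi0 : Phi 0 = 0.
    by rewrite /Phi big1 // => i _; have [_ -> _] := psiP i; rewrite mulr0.
  have Br : B r <= 0.
    rewrite /B mulNr oppr_le0 mulr_ge0 ?exprn_ge0 ?invr_ge0 ?(ltW (den0 _ r0)) //.
    by rewrite divr_ge0 // mulr_ge0 ?ltW.
  have B0 : B 0 = - k by rewrite /B mulr0 addr0 invr1 expr1n mulr1.
  (* [B - Phi] is nondecreasing, hence Phi r <= B r - B 0 <= k. *)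
  suff H : B 0 - Phi 0 <= B r - Phi r by lra.
  pose dF x := M * (1 + tau * c * x)^-1 ^+ m.+2 - Im (e * G x ^+ m.+2 * S x).
  suff dF0 x : 0 <= x -> 0 <= dF x.
    exact: (@ge0_derive_ge R (B - Phi) dF (fun x x0 => is_deriveB (dB x x0) (dPhi x)) dF0 r r0).
  move=> x0; rewrite subr_ge0.
  apply: (le_trans (ler_norm _)); apply: (le_trans (normr_Im_le _)); rewrite 2!normcM.
  have -> : normc e = 1 by rewrite /= sqrrN cs1 sqrtr1.
  rewrite mul1r mulrC normcX ler_pM ?exprn_ge0 ?normc_ge0 ?resolvent_le //.
  rewrite lerXn2r ?nnegrE ?normc_ge0 //.
    by rewrite invr_ge0 ltW // den0.
  exact: normc_one_minus_ray.
have : pi * \sum_i p i * (1 + tau * a i)^-1 ^+ m.+2 <= k.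
  have cv : Phi r @[r --> +oo] --> pi * \sum_i p i * (1 + tau * a i)^-1 ^+ m.+2.
    rewrite mulr_sumr; apply: cvg_bigsum => i; have [_ _ H] := psiP i.
    by rewrite mulrCA; exact: cvgZr.
  apply: (cvgr_to_le cv); near=> r; apply: cmp.
  by near: r; exact: nbhs_pinfty_ge.
rewrite -ler_pdivlMl ?pi_gt0 // => /le_trans; apply.
by rewrite /k [in leRHS]invfM [leRHS]mulrCA.
Unshelve. all: by end_near. Qed.

(** Take [tau] = t / (n+2) with exponent n+2: the rational bound is M / (pi t c) times (n+2) /
    (n+1), and n tends to infinity on both sides. *)
Lemma exp_sum_le (t : R) : 0 < t ->
  \sum_i p i * expR (- (t * a i)) <= M / (pi * (t * c)).
Proof.
move=> t0.
have H n : \sum_i p i * (1 + t * a i / n.+2%:R)^-1 ^+ n.+2 <=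
    M / (pi * (t * c)) * (1 + n.+1%:R^-1).
  have /rational_sum_le : 0 < t / n.+2%:R by rewrite divr_gt0.
  move=> /(_ n).
  under eq_bigr do rewrite mulrAC.
  move=> /le_trans; apply; rewrite le_eqVlt; apply/orP; left; apply/eqP.
  rewrite -[n.+2%:R]natr1.
  have := pi_gt0 R; have : (0 : R) < n.+1%:R by [].
  move: (n.+1%:R) (@pi R) => N q N0 q0.
  by field; rewrite !gt_eqF // addr_gt0.
have cvl : (\sum_i p i * (1 + t * a i / n.+2%:R)^-1 ^+ n.+2) @[n --> \oo] -->
    \sum_i p i * expR (- (t * a i)).
  apply: cvg_bigsum => i; apply: cvgZr; apply: cvg_inv_1Dxn_expR.
  by rewrite mulr_ge0 // ltW.
have cvr : (M / (pi * (t * c)) * (1 + n.+1%:R^-1)) @[n --> \oo] -->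
    M / (pi * (t * c)) * (1 + 0).
  apply: cvgZr; apply: cvgD; first exact: cvg_cst.
  exact: cvg_harmonic.
rewrite -[leRHS]mulr1 -[X in _ <= _ * X]addr0.
by apply: (ler_cvg_to cvl cvr); near=> n; exact: H.
Unshelve. all: by end_near. Qed.
End ray_sum.

(** * Real symmetric matrices *)

Lemma mulmx_trr_ge0 (R : realType) n (v : 'rV[R]_n) : 0 <= (v *m v^T) 0 0.
Proof. by rewrite mxE; apply: sumr_ge0 => i _; rewrite mxE -expr2 sqr_ge0. Qed.

Lemma mulmx_trr_eq0 (R : realType) n (v : 'rV[R]_n) :
  ((v *m v^T) 0 0 == 0) = (v == 0).
Proof.
apply/idP/eqP => [|->]; last by rewrite mul0mx mxE.
rewrite mxE psumr_eq0; last by move=> i _; rewrite mxE -expr2 sqr_ge0.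
move=> /allP v0; apply/rowP => j; rewrite [RHS]mxE; apply/eqP.
by have := v0 j (mem_index_enum _); rewrite mxE -expr2 sqrf_eq0.
Qed.

(** Over [R[i]] the matrix is Hermitian, so the spectral theorem gives a real eigenvalue. It is a
    root of the characteristic polynomial over [R] too, hence has a real eigenvector, which is then
    normalised. *)
Lemma symmetric_has_eigenvector (R : realType) n (A : 'M[R]_n.+1) : A^T = A ->
  exists (l : R) (v : 'rV[R]_n.+1), v *m A = l *: v /\ v *m v^T = 1%:M.
Proof.
move=> Asym; pose AC := map_mx (real_complex R) A.
have ACsym : AC \is symmetricmx.
  by apply/is_hermitianmxP; rewrite expr0 scale1r map_mx_id // map_trmx Asym.
have ACreal : AC \is a mxOver Num.real.
  by apply/mxOverP => i j; rewrite mxE complex_real.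
have [P [sp [spr Pu PA]]] : exists P sp, [/\ sp \is a mxOver Num.real,
    P \in unitmx & P *m AC = diag_mx sp *m P].
  exists (spectralmx AC), (spectral_diag AC); split.
  - by apply: hermitian_spectral_diag_real; apply: realsym_hermsym.
  - exact: spectral_unit.
  - have /orthomx_spectralP E := symmetric_normalmx ACsym ACreal.
    rewrite [X in _ *m X = _]E.
    by rewrite !mulmxA mulmxV ?spectral_unit // mul1mx.
have ev : eigenvalue AC (sp 0 0).
  apply/eigenvalueP; exists (row 0 P).
    by rewrite -row_mul PA row_mul row_diag_mx -scalemxAl -rowE.
  apply/negP => /eqP r0; move: Pu; rewrite -row_free_unit -kermx_eq0.
  move=> /eqP/matrixP K; have : (delta_mx 0 0 : 'rV_n.+1) *m P = 0 by rewrite -rowE.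
  move=> /sub_kermxP; rewrite (_ : kermx P = 0); last exact/matrixP.
  rewrite submx0 => /eqP/matrixP/(_ 0 0); rewrite !mxE !eqxx /= => /eqP.
  by rewrite oner_eq0.
have := ev; rewrite eigenvalue_root_char -map_char_poly.
have -> : sp 0 0 = real_complex R (complex.Re (sp 0 0)).
  by rewrite RRe_real //; exact: (mxOverP spr).
rewrite fmorph_root -eigenvalue_root_char => /eigenvalueP[v vA v0].
have vv0 : 0 < (v *m v^T) 0 0.
  by rewrite lt_def mulmx_trr_eq0 v0 mulmx_trr_ge0.
exists (complex.Re (sp 0 0)), ((Num.sqrt ((v *m v^T) 0 0))^-1 *: v); split.
  by rewrite -scalemxAl vA !scalerA mulrC.
rewrite linearZ /= -scalemxAl -scalemxAr scalerA -invfM -expr2 sqr_sqrtr ?ltW //.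
by rewrite [X in _ *: X]mx11_scalar scale_scalar_mx mulVf // gt_eqF.
Qed.

(* The Householder reflection exchanging [v] and the first basis vector. *)
Lemma orthogonal_first_row (R : realType) n (v : 'rV[R]_n.+1) : v *m v^T = 1%:M ->
  exists H : 'M[R]_n.+1, [/\ H^T = H, H *m H = 1%:M & delta_mx 0 0 *m H = v].
Proof.
move=> vv; pose e1 : 'rV[R]_n.+1 := delta_mx 0 0.
have ee : e1 *m e1^T = 1%:M.
  by rewrite trmx_delta mul_delta_mx; apply/matrixP => i j; rewrite !ord1 !mxE.
pose u := v - e1; pose q := (u *m u^T) 0 0.
have uu : u *m u^T = q%:M by rewrite -mx11_scalar.
have [u0|u0] := eqVneq u 0.
  exists 1%:M; split; rewrite ?trmx1 ?mulmx1 //.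
  by apply/eqP; rewrite eq_sym -subr_eq0; apply/eqP.
have q0 : q != 0 by rewrite mulmx_trr_eq0.
pose p := (e1 *m v^T) 0 0.
have ev : e1 *m v^T = p%:M by rewrite -mx11_scalar.
have ve : v *m e1^T = p%:M by rewrite -[v *m _]trmxK trmx_mul trmxK ev tr_scalar_mx.
(* Both vectors have length 1 and inner product [p]; this makes the coefficient 2 / q (p - 1) below
   equal to -1. *)
have qE : q = 2 - 2 * p.
  have : u *m u^T = (2 - 2 * p)%:M.
    rewrite /u linearB /= mulmxBl !mulmxBr vv ve ev ee -!raddfB /=.
    by congr (_%:M); ring.
  by rewrite uu => /matrixP/(_ 0 0); rewrite !mxE /= !mulr1n.
have eu : e1 *m u^T = (p - 1)%:M by rewrite linearB /= mulmxBr ev ee -raddfB.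
have uE : u = v - e1 by [].
move: uE uu q0 qE eu; clearbody q u; move=> uE uu q0 qE eu {u0}.
exists (1%:M - (2 / q) *: (u^T *m u)); split.
- by rewrite linearB linearZ /= trmx1 trmx_mul trmxK.
- rewrite mulmxBl mul1mx mulmxBr mulmx1 -scalemxAl -scalemxAr.
  rewrite -mulmxA (mulmxA u) uu mul_scalar_mx -scalemxAr !scalerA.
  have -> : 2 / q * (2 / q * q) = 2 / q + 2 / q by field.
  by rewrite scalerDl opprB addrK subrK.
- rewrite mulmxBr mulmx1 -scalemxAr mulmxA eu mul_scalar_mx scalerA.
  have -> : 2 / q * (p - 1) = - 1.
    have qp : 2 - 2 * p != 0 by rewrite -qE.
    by rewrite qE; field.
  by rewrite scaleN1r opprK uE addrC subrK.
Qed.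

(** Deflation: a reflection moves a unit eigenvector to the first basis vector. The first row of the
    conjugate [B] is then a multiple of that vector, symmetry clears the first column, and induction
    applies to the remaining block. *)
Lemma symmetric_spectral (R : realType) n (A : 'M[R]_n) : A^T = A ->
  exists (Q : 'M[R]_n) (a : 'rV[R]_n), Q^T *m Q = 1%:M /\ A = Q *m diag_mx a *m Q^T.
Proof.
elim: n A => [|n IH] A Asym.
  exists 1%:M, 0; split; first by rewrite trmx1 mulmx1.
  by apply/matrixP => -[].
have [l [v [vA vv]]] := symmetric_has_eigenvector Asym.
have [H [Hsym HH He]] := orthogonal_first_row vv.
pose B : 'M[R]_(1 + n) := H *m A *m H.
have Bsym : B^T = B by rewrite /B !trmx_mul Hsym Asym mulmxA.
have e1B : delta_mx 0 0 *m B = l *: delta_mx 0 0 :> 'rV[R]_(1 + n).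
  rewrite /B !mulmxA He vA -scalemxAl; congr (_ *: _).
  by rewrite -He -mulmxA HH mulmx1.
have Bu : ursubmx B = 0.
  apply/rowP => j; rewrite !mxE; have /rowP/(_ (rshift 1 j)) := e1B.
  rewrite -rowE !mxE (_ : lshift n 0 = 0); last exact/val_inj.
  by move=> ->; rewrite eqxx -val_eqE /= mulr0.
have Bl : ulsubmx B = l%:M.
  apply/matrixP => i j; rewrite !ord1 !mxE.
  have /rowP/(_ 0) := e1B; rewrite -rowE !mxE (_ : lshift n 0 = 0); last exact/val_inj.
  by move=> ->; rewrite mulr1.
have Bd : dlsubmx B = 0.
  by rewrite -Bsym -trmx_ursub Bu trmx0.
have [Q [a [QQ Ba]]] : exists (Q : 'M[R]_n) (a : 'rV[R]_n),
    Q^T *m Q = 1%:M /\ drsubmx B = Q *m diag_mx a *m Q^T.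
  by apply: IH; rewrite trmx_drsub Bsym.
pose Q1 : 'M[R]_(1 + n) := block_mx 1%:M 0 0 Q.
have Q1Q1 : Q1^T *m Q1 = 1%:M.
  rewrite /Q1 tr_block_mx mulmx_block !trmx0 trmx1 !(mulmx0, mul0mx, addr0, add0r).
  by rewrite mulmx1 QQ -scalar_mx_block.
exists (H *m Q1), (row_mx l%:M a); split.
  rewrite trmx_mul mulmxA -(mulmxA _ _ H) Hsym HH mulmx1; exact: Q1Q1.
have -> : A = H *m B *m H by rewrite /B !mulmxA HH mul1mx -mulmxA HH mulmx1.
clearbody B.
rewrite trmx_mul Hsym !mulmxA; congr (_ *m _); rewrite -!mulmxA; congr (_ *m _).
have -> : diag_mx (row_mx l%:M a) = block_mx l%:M 0 0 (diag_mx a) :> 'M[R]_(1 + n).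
  rewrite diag_mx_row; congr block_mx.
  by apply/matrixP => i j; rewrite !ord1 !mxE /= mulr1n.
suff BQ : B = Q1 *m (block_mx l%:M 0 0 (diag_mx a) *m Q1^T) :> 'M[R]_(1 + n) by exact: BQ.
rewrite /Q1 tr_block_mx !mulmx_block !trmx0 trmx1.
rewrite !(mulmx0, mul0mx, addr0, add0r, mul1mx, mulmx1) mulmxA -Ba.
by rewrite -[LHS]submxK Bu Bl Bd.
Qed.

(** * Singular values and norms of symmetric matrices *)

Lemma char_poly_orthogonal_diag (R : realType) n (Q : 'M[R]_n) (b : 'rV[R]_n) :
  Q^T *m Q = 1%:M ->
  char_poly (Q *m diag_mx b *m Q^T) = \prod_i ('X - (b 0 i)%:P).
Proof.
move=> QQ; have QQ' := mulmx1C QQ.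
transitivity (char_poly (diag_mx b)).
  pose Qp := map_mx polyC Q.
  have Qp1 : Qp *m Qp^T = 1%:M by rewrite /Qp map_trmx -map_mxM QQ' map_mx1.
  have E : char_poly_mx (Q *m diag_mx b *m Q^T) =
      Qp *m char_poly_mx (diag_mx b) *m Qp^T.
    rewrite /char_poly_mx !map_mxM /= -map_trmx -/Qp mulmxBr mulmxBl.
    by rewrite scalar_mxC -[_ *m Qp *m _]mulmxA Qp1 mulmx1.
  by rewrite /char_poly E !det_mulmx mulrAC -det_mulmx Qp1 det1 mul1r.
rewrite char_poly_trig ?diag_mx_is_trig //; apply: eq_bigr => i _.
by rewrite mxE eqxx.
Qed.

(** Undoes the encoding used in [singular_values] once the polynomial is split: multiplicities of
    roots are counts in [s], and the distinct roots are those of [undup s]. *)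
Lemma perm_roots_prod_XsubC (R : rcfType) (s : seq R) :
  perm_eq (flatten [seq nseq (mup x (\prod_(y <- s) ('X - y%:P))) x |
    x <- rootsR (\prod_(y <- s) ('X - y%:P))]) s.
Proof.
set p := \prod_(y <- s) _; apply: perm_trans (perm_count_undup s); apply: perm_flatten.
have -> : [seq nseq (mup x p) x | x <- rootsR p] =
    [seq nseq (count_mem x s) x | x <- rootsR p].
  by apply: eq_map => x; rewrite mu_prod_XsubC.
apply: perm_map; apply: uniq_perm (undup_uniq s) _; first exact: uniq_roots.
have p0 : p != 0 by rewrite monic_neq0 // monic_prod_XsubC.
move=> x; have := roots_on_rootsR p0 x; rewrite !inE /= => <-.
by rewrite root_prod_XsubC mem_undup.
Qed.

(** A^T A has the eigenvalues a_i^2 in the same basis. Equality up to permutation suffices, since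
    maximum and sum ignore order. *)
Lemma perm_singular_values (R : realType) n (Q : 'M[R]_n) (a : 'rV[R]_n) :
  Q^T *m Q = 1%:M ->
  perm_eq (singular_values (Q *m diag_mx a *m Q^T)) [seq `|a 0 i| | i <- enum 'I_n].
Proof.
move=> QQ; pose s := [seq (a 0 i) ^+ 2 | i <- enum 'I_n].
have pE : char_poly ((Q *m diag_mx a *m Q^T)^T *m (Q *m diag_mx a *m Q^T)) =
    \prod_(x <- s) ('X - x%:P).
  rewrite big_map big_enum /=.
  transitivity (char_poly (Q *m diag_mx (\row_i (a 0 i) ^+ 2) *m Q^T)).
    congr char_poly; rewrite !trmx_mul trmxK tr_diag_mx -!mulmxA; congr (_ *m _).
    rewrite (mulmxA Q^T) QQ mul1mx mulmxA mulmx_diag; congr (diag_mx _ *m _).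
  by rewrite char_poly_orthogonal_diag //; apply: eq_bigr => i _; rewrite mxE.
rewrite /singular_values pE.
have -> : [seq `|a 0 i| | i <- enum 'I_n] = map Num.sqrt s.
  rewrite /s -[RHS]map_comp.
  by congr map; apply/funext => i /=; rewrite sqrtr_sqr.
have := perm_map Num.sqrt (perm_roots_prod_XsubC s); congr perm_eq.
rewrite map_flatten -map_comp; congr flatten; apply: eq_map => x /=.
by rewrite map_nseq.
Qed.

(** The conjunct [0 <= x] comes from the default value 0 of the maximum and matters when n = 0. *)
Lemma spectral_norm_diag_le (R : realType) n (Q : 'M[R]_n) (a : 'rV[R]_n) (x : R) :
  Q^T *m Q = 1%:M ->
  (spectral_norm (Q *m diag_mx a *m Q^T) <= x) =
  (0 <= x) && [forall i, `|a 0 i| <= x].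
Proof.
move=> QQ; rewrite /spectral_norm (perm_big _ (perm_singular_values a QQ)) /=.
rewrite big_map big_enum /=.
apply/bigmax_leP/andP => [[x0 H]|[x0 /forallP H]]; split => //.
by apply/forallP => i; exact: H.
Qed.

Lemma nuclear_norm_diag (R : realType) n (Q : 'M[R]_n) (a : 'rV[R]_n) :
  Q^T *m Q = 1%:M ->
  nuclear_norm (Q *m diag_mx a *m Q^T) = \sum_i `|a 0 i|.
Proof.
move=> QQ; rewrite /nuclear_norm (perm_big _ (perm_singular_values a QQ)) /=.
by rewrite big_map big_enum.
Qed.

(** * The exponential of a diagonalised matrix *)

Lemma cvg_mx_coord (R : realType) m n (F : nat -> 'M[R]_(m, n)) (A : 'M[R]_(m, n)) :
  (forall i j, F k i j @[k --> \oo] --> A i j) -> F k @[k --> \oo] --> A.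
Proof.
move=> H; apply/cvg_ballP => e e0.
have : \forall k \near \oo, forall ij : 'I_m * 'I_n, ball (A ij.1 ij.2) e (F k ij.1 ij.2).
  apply: filter_forall => -[i j] /=.
  by have /cvg_ballP := H i j; apply.
by apply: filterS => k Hk; split=> // i j; exact: (Hk (i, j)).
Qed.

(** Powers act on the diagonal alone, so each entry of a partial sum is a fixed finite combination
    of partial sums of scalar exponential series. *)
Lemma expmx_orthogonal_diag (R : realType) n (Q : 'M[R]_n) (a : 'rV[R]_n) :
  Q^T *m Q = 1%:M ->
  expmx (Q *m diag_mx a *m Q^T) = Q *m diag_mx (\row_i expR (a 0 i)) *m Q^T.
Proof.
move=> QQ; rewrite /expmx; apply: cvg_lim; first exact: norm_hausdorff.
have powE k : (Q *m diag_mx a *m Q^T) ^+ k = Q *m diag_mx (\row_i (a 0 i) ^+ k) *m Q^T.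
  elim: k => [|k IH].
    rewrite expr0 (_ : diag_mx _ = 1%:M) ?mulmx1 ?(mulmx1C QQ) //.
    by apply/matrixP => i j; rewrite !mxE expr0.
  rewrite exprS IH -mulmxE -!mulmxA; congr (_ *m _).
  rewrite (mulmxA Q^T) QQ mul1mx mulmxA mulmx_diag; congr (diag_mx _ *m _).
  by apply/rowP => i; rewrite !mxE exprS.
apply: cvg_mx_coord => i j.
have entry (b : 'rV[R]_n) : (Q *m diag_mx b *m Q^T) i j = \sum_l (Q i l * Q j l) * b 0 l.
  by rewrite mxE; apply: eq_bigr => l _; rewrite mul_mx_diag !mxE mulrAC.
have -> : (fun k => series (fun k => k`!%:R^-1 *: (Q *m diag_mx a *m Q^T) ^+ k) k i j) =
    (fun k => \sum_l (Q i l * Q j l) * series (exp_coeff (a 0 l)) k).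
  apply/funext => k; rewrite /series /= summxE.
  transitivity (\sum_(0 <= p < k) \sum_l (Q i l * Q j l) * exp_coeff (a 0 l) p).
    apply: eq_bigr => p _; rewrite powE mxE entry mulr_sumr.
    by apply: eq_bigr => l _; rewrite mxE /exp_coeff /= mulrCA [_^-1 * _]mulrC.
  by rewrite exchange_big; apply: eq_bigr => l _; rewrite mulr_sumr.
rewrite entry; apply: cvg_bigsum => l; rewrite mxE.
by apply: cvgZr; exact: is_cvg_series_exp_coeff.
Qed.

(** * Resolvents *)

Section resolvent_entries.
Variables (R : realType) (n : nat).

(** The common form of (1 + zK)^-1 and (1 + zA)^-1: with [mu] from [resolvent_mu], 1 - mu_j = a_j /
    (z + a_j). *)
Definition compl_diag (k : nat) (W : 'M[R]_(n, k)) (mu : 'rV[R[i]]_k) : 'M[R[i]]_n :=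
  1%:M - toC W *m diag_mx mu *m toC W^T.

(* [compl_diag W mu] acts as [1 - mu_j] on the columns of [W] and as the
   identity on their orthogonal complement. *)
Lemma sum_sqr_normc_compl (k : nat) (W : 'M[R]_(n, k)) (mu : 'rV[R[i]]_k)
    (S T : 'M[R]_n) l :
  W^T *m W = 1%:M -> S^T *m S = 1%:M -> T^T *m T = 1%:M ->
  \sum_i normc ((toC S^T *m compl_diag W mu *m toC T) i l) ^+ 2 =
  1 + \sum_j (normc (1 - mu 0 j) ^+ 2 - 1) * ((W^T *m T) j l) ^+ 2.
Proof.
move=> WW SS TT; apply: (@complexI R); set N := compl_diag W mu.
set B := toC S^T *m N *m toC T.
have conjR m1 m2 (X : 'M[R]_(m1, m2)) : map_mx conjc (toC X) = toC X.
  by apply/matrixP => i j; rewrite !mxE /= oppr0.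
rewrite rmorph_sum /=.
under eq_bigr do rewrite sqr_normcE.
have -> : \sum_i conjc (B i l) * B i l = ((map_mx conjc B)^T *m B) l l.
  by rewrite mxE; apply: eq_bigr => i _; rewrite !mxE.
pose rho : 'rV[R[i]]_k := \row_j ((normc (1 - mu 0 j) ^+ 2 - 1)%:C).
(* W^T W = 1 collapses the product of the two [W] terms, leaving |mu|^2 - 2 Re mu = |1 - mu|^2 - 1
   on the diagonal. *)
have NN : (map_mx conjc N)^T *m N = 1%:M + toC W *m diag_mx rho *m toC W^T.
  have -> : (map_mx conjc N)^T = 1%:M - toC W *m diag_mx (map_mx conjc mu) *m toC W^T.
    rewrite /N /compl_diag map_mxB !map_mxM map_mx1 !conjR map_diag_mx linearB /= trmx1.
    by rewrite !trmx_mul tr_diag_mx -!map_trmx trmxK mulmxA.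
  rewrite /N /compl_diag mulmxBl mul1mx mulmxBr mulmx1.
  set D1 := diag_mx (map_mx conjc mu); set D2 := diag_mx mu.
  have -> : toC W *m D1 *m toC W^T *m (toC W *m D2 *m toC W^T) =
     toC W *m (D1 *m D2) *m toC W^T.
    rewrite -!mulmxA; congr (_ *m (_ *m _)); rewrite mulmxA -map_mxM WW map_mx1.
    by rewrite mul1mx.
  have -> : diag_mx rho = D1 *m D2 - D1 - D2.
    rewrite /D1 /D2 mulmx_diag -!raddfB /=; congr diag_mx; apply/rowP => j.
    rewrite !mxE rmorphB rmorph1 /= sqr_normcE rmorphB rmorph1 /=; ring.
  clearbody D1 D2; move: (toC W) (toC W^T) => X Y.
  have -> : X *m (D1 *m D2 - D1 - D2) *m Y =
      X *m (D1 *m D2) *m Y - X *m D1 *m Y - X *m D2 *m Y.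
    by rewrite 2!mulmxBr 2!mulmxBl.
  move: (X *m _ *m Y) (X *m D1 *m Y) (X *m D2 *m Y) => p q r.
  by rewrite opprB -addrA; congr (_ + _); rewrite addrC.
have -> : (map_mx conjc B)^T *m B = toC T^T *m ((map_mx conjc N)^T *m N) *m toC T.
  rewrite /B !map_mxM !conjR !trmx_mul !map_trmx trmxK -!mulmxA.
  congr (_ *m (_ *m _)); rewrite mulmxA -map_mxM (mulmx1C SS) map_mx1 mul1mx.
  by [].
rewrite NN mulmxDr mulmxDl mulmx1 -map_mxM TT map_mx1 mxE rmorphD rmorph1.
rewrite [_%:M _ _]mxE eqxx; congr (_ + _).
rewrite !mulmxA -map_mxM -mulmxA -map_mxM.
have -> : T^T *m W = (W^T *m T)^T by rewrite trmx_mul trmxK.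
move: (W^T *m T) => X; rewrite mxE rmorph_sum; apply: eq_bigr => j _.
by rewrite mul_mx_diag !mxE rmorphM rmorphXn /=; ring.
Qed.

(** For mu = 1, [compl_diag] is the projection onto the complement of the columns of [W]; 1 minus
    the sum is the squared length of a projected unit vector. *)
Lemma bessel (k : nat) (W : 'M[R]_(n, k)) (T : 'M[R]_n) l :
  W^T *m W = 1%:M -> T^T *m T = 1%:M -> \sum_j ((W^T *m T) j l) ^+ 2 <= 1.
Proof.
move=> WW TT.
have H := sum_sqr_normc_compl (const_mx 1) l WW TT TT; move: H.
rewrite [in X in _ = 1 + X](eq_bigr (fun j => - ((W^T *m T) j l) ^+ 2)); last first.
  move=> j _; rewrite mxE subrr normc0.
  by rewrite expr0n /= sub0r mulN1r.
rewrite sumrN => H; rewrite -subr_ge0 -H; apply: sumr_ge0 => i _.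
exact: sqr_ge0.
Qed.

(** An excess over 1 arises only along [W], with coefficients at most kappa - 1, and [bessel] bounds
    the total weight there by 1. *)
Lemma sum_sqr_normc_compl_le (k : nat) (W : 'M[R]_(n, k)) (mu : 'rV[R[i]]_k)
    (S T : 'M[R]_n) (kappa : R) l :
  W^T *m W = 1%:M -> S^T *m S = 1%:M -> T^T *m T = 1%:M ->
  1 <= kappa -> (forall j, normc (1 - mu 0 j) ^+ 2 <= kappa) ->
  \sum_i normc ((toC S^T *m compl_diag W mu *m toC T) i l) ^+ 2 <= kappa.
Proof.
move=> WW SS TT k1 muk; rewrite sum_sqr_normc_compl //.
apply: (@le_trans _ _ (1 + (kappa - 1) * \sum_j ((W^T *m T) j l) ^+ 2)).
  rewrite lerD2l mulr_sumr; apply: ler_sum => j _.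
  by rewrite ler_wpM2r ?sqr_ge0 // lerB.
have := bessel l WW TT => H.
have : (kappa - 1) * \sum_j ((W^T *m T) j l) ^+ 2 <= (kappa - 1) * 1.
  by rewrite ler_wpM2l // subr_ge0.
lra.
Qed.

Lemma tr_compl_diag (k : nat) (W : 'M[R]_(n, k)) (mu : 'rV[R[i]]_k) :
  (compl_diag W mu)^T = compl_diag W mu.
Proof.
rewrite /compl_diag linearB /= trmx1 !trmx_mul tr_diag_mx !map_trmx trmxK.
by rewrite mulmxA.
Qed.

End resolvent_entries.

Section resolvent_difference.
Variables (R : realType) (n : nat).

(** In eigenbases: (z + L)^-1 for square orthogonal [W], and V (z + V^T L V)^-1 V^T when [W] is V
    times an eigenbasis of V^T L V. *)
Definition resolvent (k : nat) (W : 'M[R]_(n, k)) (a : 'rV[R]_k) (z : R[i]) : 'M[R[i]]_n :=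
  toC W *m diag_mx (\row_j (z + (a 0 j)%:C)^-1) *m toC W^T.

Definition resolvent_mu (k : nat) (a : 'rV[R]_k) (z : R[i]) : 'rV[R[i]]_k :=
  \row_j (z / (z + (a 0 j)%:C)).

Lemma compl_diag_resolvent (k : nat) (W : 'M[R]_(n, k)) (a : 'rV[R]_k) (z : R[i]) :
  compl_diag W (resolvent_mu a z) = 1%:M - z *: resolvent W a z.
Proof.
rewrite /compl_diag /resolvent; congr (_ - _).
rewrite scalemxAl scalemxAr -linearZ /=; congr (_ *m diag_mx _ *m _).
by apply/rowP => j; rewrite !mxE.
Qed.

(** Along the columns of [W] this is a / (z + a) times 1 / a; on their complement [A] and both
    products vanish. *)
Lemma compl_diag_mul (k : nat) (W : 'M[R]_(n, k)) (a : 'rV[R]_k) (z : R[i]) :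
  W^T *m W = 1%:M -> (forall j, 0 < a 0 j) -> (forall j, z + (a 0 j)%:C != 0) ->
  let A := toC (W *m diag_mx (\row_j (a 0 j)^-1) *m W^T) in
  compl_diag W (resolvent_mu a z) *m A = resolvent W a z /\
  A *m compl_diag W (resolvent_mu a z) = resolvent W a z.
Proof.
move=> WW a0 za0 A.
pose ai : 'rV[R[i]]_k := \row_j ((a 0 j)%:C)^-1.
have AE : A = toC W *m diag_mx ai *m toC W^T.
  rewrite /A !map_mxM map_diag_mx; congr (_ *m diag_mx _ *m _).
  by apply/rowP => j; rewrite !mxE fmorphV.
have WWC : toC W^T *m toC W = 1%:M by rewrite -map_mxM WW map_mx1.
have key (u v : 'rV[R[i]]_k) : toC W *m diag_mx u *m toC W^T *m (toC W *m diag_mx v *m toC W^T) =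
    toC W *m diag_mx (\row_j (u 0 j * v 0 j)) *m toC W^T.
  rewrite -!mulmxA (mulmxA (toC W^T)) WWC mul1mx; congr (_ *m _).
  by rewrite mulmxA mulmx_diag.
rewrite AE /compl_diag mulmxBl mul1mx mulmxBr mulmx1 !key /resolvent.
rewrite -!mulmxBl -!mulmxBr -!raddfB.
by split; congr (_ *m diag_mx _ *m _); apply/rowP => j; rewrite !mxE;
  field; rewrite za0 fmorph_eq0 gt_eqF.
Qed.

(** With M, N the outer factors, X, Y the resolvents and A, B the two inverses, the relations MA =
    X, BN = Y, M = 1 - zX, N = 1 - zY give M(A - B)N = XN - MY = X - Y, the terms zXY cancelling. *)
Lemma resolvent_diff (k : nat) (Q : 'M[R]_n) (W : 'M[R]_(n, k))
    (a : 'rV[R]_n) (b : 'rV[R]_k) (z : R[i]) :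
  Q^T *m Q = 1%:M -> W^T *m W = 1%:M ->
  (forall j, 0 < a 0 j) -> (forall j, z + (a 0 j)%:C != 0) ->
  (forall j, 0 < b 0 j) -> (forall j, z + (b 0 j)%:C != 0) ->
  resolvent Q a z - resolvent W b z =
  compl_diag Q (resolvent_mu a z) *m
    toC (Q *m diag_mx (\row_j (a 0 j)^-1) *m Q^T - W *m diag_mx (\row_j (b 0 j)^-1) *m W^T) *m
    compl_diag W (resolvent_mu b z).
Proof.
move=> QQ WW a0 za0 b0 zb0.
have [H1 _] := compl_diag_mul QQ a0 za0; have [_ H2] := compl_diag_mul WW b0 zb0.
have E1 := compl_diag_resolvent Q a z; have E2 := compl_diag_resolvent W b z.
rewrite map_mxB; move: H1 H2 E1 E2.
move: (compl_diag Q _) (compl_diag W _) (resolvent Q a z) (resolvent W b z) => M N X Y.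
move: (toC (Q *m _ *m _)) (toC (W *m _ *m _)) => A B H1 H2 E1 E2.
rewrite mulmxBr mulmxBl H1 -mulmxA H2 E1 E2 mulmxBr mulmxBl mulmx1 mul1mx.
by rewrite -scalemxAl -scalemxAr opprB addrA subrK.
Qed.

(** The coefficients are independent of z and reappear in [exp_entry], so [exp_sum_le] carries a
    bound on resolvents over to exponentials. *)
Lemma resolvent_entry (k : nat) (W : 'M[R]_(n, k)) (a : 'rV[R]_k) (z : R[i]) (T : 'M[R]_n) l :
  (toC T^T *m resolvent W a z *m toC T) l l =
  \sum_j (((W^T *m T) j l) ^+ 2)%:C / (z + (a 0 j)%:C).
Proof.
rewrite /resolvent !mulmxA -map_mxM -mulmxA -map_mxM.
have -> : T^T *m W = (W^T *m T)^T by rewrite trmx_mul trmxK.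
move: (W^T *m T) => X; rewrite mxE; apply: eq_bigr => j _.
by rewrite mul_mx_diag !mxE rmorphXn /=; ring.
Qed.

Lemma exp_entry (k : nat) (W : 'M[R]_(n, k)) (f : 'rV[R]_k) (T : 'M[R]_n) l :
  (T^T *m (W *m diag_mx f *m W^T) *m T) l l = \sum_j ((W^T *m T) j l) ^+ 2 * f 0 j.
Proof.
rewrite !mulmxA -mulmxA.
have -> : T^T *m W = (W^T *m T)^T by rewrite trmx_mul trmxK.
move: (W^T *m T) => X; rewrite mxE; apply: eq_bigr => j _.
by rewrite mul_mx_diag !mxE; ring.
Qed.

(** The difference is b / (z + b), and |z + b| is at least the distance b s from -b to the line of
    the ray, as |z + b|^2 = (r - bc)^2 + (bs)^2. *)
Lemma normc_ray_quot (c s b r : R) : 0 < c -> 0 < s -> c ^+ 2 + s ^+ 2 = 1 -> 0 < b ->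
  normc (1 - Complex (- c) s * r%:C / (Complex (- c) s * r%:C + b%:C)) ^+ 2 <= (s ^+ 2)^-1.
Proof.
move=> c0 s0 cs1 b0; have := ray_plus_neq0 c s0 r b0.
set z := Complex (- c) s * r%:C => zb.
have -> : 1 - z / (z + b%:C) = b%:C / (z + b%:C) by field.
rewrite normcM normcV exprMn exprVn.
have -> : normc b%:C ^+ 2 = b ^+ 2 by rewrite /= sqr_sqrtr ?expr0n /= ?addr0 ?sqr_ge0.
have aux : (- c * r + b) ^+ 2 + (s * r) ^+ 2 = (r - b * c) ^+ 2 + (b * s) ^+ 2.
  have -> : (- c * r + b) ^+ 2 + (s * r) ^+ 2 =
    (c ^+ 2 + s ^+ 2) * r ^+ 2 - 2 * b * c * r + b ^+ 2 by ring.
  have -> : (r - b * c) ^+ 2 + (b * s) ^+ 2 =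
    r ^+ 2 - 2 * b * c * r + b ^+ 2 * (c ^+ 2 + s ^+ 2) by ring.
  by rewrite cs1 mul1r mulr1.
have -> : normc (z + b%:C) ^+ 2 = (r - b * c) ^+ 2 + (b * s) ^+ 2.
  rewrite /z /= sqr_sqrtr ?addr_ge0 ?sqr_ge0 // !(mulr0, subr0, addr0, add0r).
  exact: aux.
have bs0 : 0 < (b * s) ^+ 2 by rewrite exprn_gt0 // mulr_gt0.
have D0 : 0 < (r - b * c) ^+ 2 + (b * s) ^+ 2 by rewrite ltr_wpDl ?sqr_ge0.
rewrite ler_pdivrMr // ler_pdivlMl ?exprn_gt0 //.
by rewrite mulrC -exprMn lerDr sqr_ge0.
Qed.

End resolvent_difference.

(** By this symmetry, bounds on sums down columns also serve for sums along rows. *)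
Lemma compl_diag_tr_entry (R : realType) (n k : nat) (W : 'M[R]_(n, k)) (mu : 'rV[R[i]]_k)
    (S T : 'M[R]_n) i l :
  (toC T^T *m compl_diag W mu *m toC S) l i = (toC S^T *m compl_diag W mu *m toC T) i l.
Proof.
transitivity ((toC T^T *m compl_diag W mu *m toC S)^T i l); first by rewrite [RHS]mxE.
by rewrite !trmx_mul tr_compl_diag !map_trmx trmxK mulmxA.
Qed.

Section exp_difference.
Variables (R : realType) (n k : nat) (c s : R).
Hypotheses (c_gt0 : 0 < c) (s_gt0 : 0 < s) (cs1 : c ^+ 2 + s ^+ 2 = 1).
Variables (Q S T : 'M[R]_n) (W : 'M[R]_(n, k)) (a ev : 'rV[R]_n) (b : 'rV[R]_k).
Hypotheses (QQ : Q^T *m Q = 1%:M) (SS : S^T *m S = 1%:M) (TT : T^T *m T = 1%:M).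
Hypotheses (WW : W^T *m W = 1%:M) (a_gt0 : forall i, 0 < a 0 i) (b_gt0 : forall j, 0 < b 0 j).
Hypothesis inv_diff :
  Q *m diag_mx (\row_j (a 0 j)^-1) *m Q^T - W *m diag_mx (\row_j (b 0 j)^-1) *m W^T =
  S *m diag_mx ev *m S^T.

Local Notation kappa := ((s ^+ 2)^-1).
Local Notation z r := (Complex (- c) s * r%:C).

(** A diagonal entry is the sum over i of the products of [B1 l i], [ev 0 i] and [B2 i l]; take
    [beta l i] = |B1 l i| |B2 i l|. Rows and columns of [B1] and [B2] have sums of squares at most
    [kappa], and 2uv <= u^2 + v^2 passes this bound on to [beta]. *)
Lemma resolvent_diff_entry_le (r : R) : 0 <= r ->
  exists beta : 'I_n -> 'I_n -> R, [/\ forall l i, 0 <= beta l i,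
    forall l, \sum_i beta l i <= kappa, forall i, \sum_l beta l i <= kappa &
    forall l, normc ((toC T^T *m (resolvent Q a (z r) - resolvent W b (z r)) *m toC T) l l) <=
      \sum_i `|ev 0 i| * beta l i].
Proof.
move=> r0.
have za j : z r + (a 0 j)%:C != 0 by apply: ray_plus_neq0.
have zb j : z r + (b 0 j)%:C != 0 by apply: ray_plus_neq0.
have kappa1 : 1 <= kappa.
  by rewrite invf_ge1 ?exprn_gt0 // -cs1 lerDr sqr_ge0.
pose B1 := toC T^T *m compl_diag Q (resolvent_mu a (z r)) *m toC S.
pose B2 := toC S^T *m compl_diag W (resolvent_mu b (z r)) *m toC T.
have B1' l i : B1 l i = (toC S^T *m compl_diag Q (resolvent_mu a (z r)) *m toC T) i l.
  exact: compl_diag_tr_entry.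
have B2' l i : B2 i l = (toC T^T *m compl_diag W (resolvent_mu b (z r)) *m toC S) l i.
  by rewrite compl_diag_tr_entry.
have ma j : normc (1 - resolvent_mu a (z r) 0 j) ^+ 2 <= kappa.
  by rewrite mxE; apply: normc_ray_quot.
have mb j : normc (1 - resolvent_mu b (z r) 0 j) ^+ 2 <= kappa.
  by rewrite mxE; apply: normc_ray_quot.
pose beta l i := normc (B1 l i) * normc (B2 i l).
have betaE l i : beta l i <= (normc (B1 l i) ^+ 2 + normc (B2 i l) ^+ 2) / 2.
  have := sqr_ge0 (normc (B1 l i) - normc (B2 i l)); rewrite /beta.
  move: (normc (B1 l i)) (normc (B2 i l)) => u v; nra.
have half (x y : R) : x <= kappa -> y <= kappa -> (x + y) / 2 <= kappa.
  by move=> ? ?; lra.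
exists beta; split.
- by move=> l i; rewrite mulr_ge0 ?normc_ge0.
- move=> l; apply: le_trans (ler_sum _ (fun i _ => betaE l i)) _.
  rewrite -mulr_suml big_split /=; apply: half.
    under eq_bigr do rewrite B1'.
    exact: sum_sqr_normc_compl_le.
  exact: sum_sqr_normc_compl_le.
- move=> i; apply: le_trans (ler_sum _ (fun l _ => betaE l i)) _.
  rewrite -mulr_suml big_split /=; apply: half.
    exact: sum_sqr_normc_compl_le.
  under eq_bigr do rewrite B2'.
  exact: sum_sqr_normc_compl_le.
- move=> l; rewrite resolvent_diff // inv_diff.
  have -> : toC T^T *m (compl_diag Q (resolvent_mu a (z r)) *m toC (S *m diag_mx ev *m S^T) *m
      compl_diag W (resolvent_mu b (z r))) *m toC T = B1 *m diag_mx (toC ev) *m B2.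
    by rewrite /B1 /B2 !map_mxM map_diag_mx !mulmxA.
  rewrite mxE; apply: le_trans (normc_sum _ _) _; apply: ler_sum => i _.
  rewrite mul_mx_diag [X in X * _]mxE !normcM /beta.
  rewrite [toC ev _ _]mxE normc_real.
  by rewrite -mulrA mulrCA.
Qed.

(** The weights [eta] select the norm: a signed unit mass isolates one eigenvalue, a sign vector
    gives the nuclear norm. As [beta] varies with r, [M] has to serve every admissible [beta]. *)
Lemma weighted_exp_diff_le (eta : 'I_n -> R) (t M : R) : 0 < t ->
  (forall beta : 'I_n -> 'I_n -> R, (forall l i, 0 <= beta l i) ->
    (forall l, \sum_i beta l i <= kappa) -> (forall i, \sum_l beta l i <= kappa) ->
    \sum_l `|eta l| * (\sum_i `|ev 0 i| * beta l i) <= M) ->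
  \sum_l eta l * (T^T *m (Q *m diag_mx (\row_j expR (- (t * a 0 j))) *m Q^T -
     W *m diag_mx (\row_j expR (- (t * b 0 j))) *m W^T) *m T) l l <=
  M / (pi * (t * c)).
Proof.
move=> t0 HM.
(* One index set for both operators: [inl] for the full matrix, [inr], with a minus sign, for the
   compressed one. *)
pose p (x : 'I_n + 'I_k) : R := match x with
  | inl i => \sum_l eta l * ((Q^T *m T) i l) ^+ 2
  | inr j => - \sum_l eta l * ((W^T *m T) j l) ^+ 2 end.
pose d (x : 'I_n + 'I_k) : R := match x with inl i => a 0 i | inr j => b 0 j end.
have d0 x : 0 < d x by case: x.
have Hd r : 0 <= r -> normc (\sum_x (p x)%:C / (z r + (d x)%:C)) <= M.
  move=> r0.
  have swap m (h : 'I_m -> R[i]) (x : 'I_m -> 'I_n -> R) :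
      \sum_j (\sum_l eta l * x j l)%:C / h j =
      \sum_l (eta l)%:C * \sum_j (x j l)%:C / h j.
    under eq_bigr do rewrite rmorph_sum mulr_suml.
    rewrite exchange_big; apply: eq_bigr => l _; rewrite mulr_sumr.
    by apply: eq_bigr => j _; rewrite rmorphM mulrA.
  have -> : \sum_x (p x)%:C / (z r + (d x)%:C) = \sum_l (eta l)%:C *
      (toC T^T *m (resolvent Q a (z r) - resolvent W b (z r)) *m toC T) l l.
    rewrite big_sumType /= swap.
    under [X in _ + X]eq_bigr do rewrite rmorphN mulNr.
    rewrite sumrN swap -sumrB; apply: eq_bigr => l _.
    rewrite -mulrBr; congr (_ * _).
    rewrite mulmxBr mulmxBl [RHS]mxE [X in _ = _ + X]mxE !resolvent_entry.
    by [].
  have [beta [b1 b2 b3 b4]] := resolvent_diff_entry_le r0.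
  apply: le_trans (HM beta b1 b2 b3); apply: le_trans (normc_sum _ _) _.
  apply: ler_sum => l _; rewrite normcM.
  by rewrite normc_real ler_wpM2l.
have := exp_sum_le c_gt0 s_gt0 cs1 d0 Hd t0; congr (_ <= _).
have swap m (h : 'I_m -> R) (x : 'I_m -> 'I_n -> R) :
    \sum_j (\sum_l eta l * x j l) * h j = \sum_l eta l * \sum_j x j l * h j.
  under eq_bigr do rewrite mulr_suml.
  rewrite exchange_big; apply: eq_bigr => l _; rewrite mulr_sumr.
  by apply: eq_bigr => j _; rewrite mulrA.
rewrite big_sumType /= swap.
under [X in _ + X]eq_bigr do rewrite mulNr.
rewrite sumrN swap -sumrB; apply: eq_bigr => l _.
rewrite -mulrBr; congr (_ * _).
rewrite mulmxBr mulmxBl [RHS]mxE [X in _ = _ + X]mxE !exp_entry.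
by congr (_ - _); apply: eq_bigr => j _; rewrite mxE.
Qed.

End exp_difference.

(** * Positive definite matrices and the final estimate *)

Lemma posdefmx_spectral (R : realType) (n : nat) (A : 'M[R]_n) : posdefmx A ->
  exists (Q : 'M[R]_n) (a : 'rV[R]_n),
    [/\ Q^T *m Q = 1%:M, A = Q *m diag_mx a *m Q^T & forall i, 0 < a 0 i].
Proof.
move=> [Asym Apos].
have At : A^T = A.
  by have /is_hermitianmxP := Asym; rewrite expr0 scale1r map_mx_id // => <-.
have [Q [a [QQ AE]]] := symmetric_spectral At.
exists Q, a; split => // i.
have x0 : col i Q != 0.
  apply/eqP => x0; have /matrixP/(_ i i) := QQ; rewrite !mxE eqxx /= => /eqP.
  rewrite big1 => [|j _]; first by rewrite eq_sym oner_eq0.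
  by have /colP/(_ j) := x0; rewrite !mxE => ->; rewrite mulr0.
suff -> : a 0 i = ((col i Q)^T *m A *m col i Q) 0 0 by exact: Apos.
have QAQ : Q^T *m A *m Q = diag_mx a.
  by rewrite AE !mulmxA QQ mul1mx -mulmxA QQ mulmx1.
rewrite tr_col -row_mul; transitivity ((Q^T *m A *m Q) i i).
  by rewrite QAQ mxE eqxx.
move: (Q^T *m A) => X; rewrite !mxE.
by apply: eq_bigr => j _; rewrite [row _ _ _ _]mxE [col _ _ _ _]mxE.
Qed.

Lemma invmx_orthogonal_diag (R : realType) (n : nat) (Q : 'M[R]_n) (a : 'rV[R]_n) :
  Q^T *m Q = 1%:M -> (forall i, 0 < a 0 i) ->
  invmx (Q *m diag_mx a *m Q^T) = Q *m diag_mx (\row_i (a 0 i)^-1) *m Q^T.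
Proof.
move=> QQ a0; set X := RHS; set A := (Q *m _ *m _).
have AX : A *m X = 1%:M.
  rewrite /A /X -!mulmxA (mulmxA Q^T) QQ mul1mx (mulmxA (diag_mx _)) mulmx_diag.
  rewrite (_ : diag_mx _ = 1%:M) ?mul1mx ?(mulmx1C QQ) //.
  apply/matrixP => i j; rewrite !mxE; congr (_ *+ _).
  by rewrite mulfV // gt_eqF.
have [uA _] := mulmx1_unit AX.
by rewrite -[LHS]mulmx1 -AX mulKmx.
Qed.

Theorem mainTheorem2 (R : realType) (n k : nat) (L : 'M[R]_n)
    (V : 'M[R]_(n, k)) (t : R)
    (L_pd : posdefmx L) (V_orth : V^T *m V = 1%:M) (t_gt0 : 0 < t) :
  let K := invmx L in
  let P := expmx (- (t *: L)) in
  let Pt := V *m expmx (- (t *: (V^T *m L *m V))) *m V^T in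
  let E := K - V *m invmx (V^T *m L *m V) *m V^T in
  let nu2 := spectral_norm E in
  let nuS := nuclear_norm E in
  let c := (3 * Num.sqrt 3) / (2 * pi) in
  spectral_norm (P - Pt) <= c * (nu2 / t) /\
  nuclear_norm (P - Pt) <= c * (nuS / t).
Proof.
move=> K P Pt E nu2 nuS c.
have [Q [a [QQ LE a0]]] := posdefmx_spectral L_pd.
have LV_pd : posdefmx (V^T *m L *m V).
  have [Lsym Lpos] := L_pd; split.
    apply/is_hermitianmxP; rewrite expr0 scale1r map_mx_id //.
    rewrite !trmx_mul trmxK mulmxA; congr (_ *m _ *m _).
    by have /is_hermitianmxP := Lsym; rewrite expr0 scale1r map_mx_id.
  (* [V] is injective because V^T V = 1. *)
  move=> x x0; have Vx0 : V *m x != 0.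
    apply: contra x0 => /eqP Vx; apply/eqP.
    by rewrite -[x]mul1mx -V_orth -mulmxA Vx mulmx0.
  by have := Lpos _ Vx0; rewrite trmx_mul !mulmxA.
have [U [b [UU LVE b0]]] := posdefmx_spectral LV_pd.
(* An orthonormal frame in which both [Pt] and V (V^T L V)^-1 V^T are diagonal. *)
pose W := V *m U.
have WW : W^T *m W = 1%:M.
  by rewrite /W trmx_mul -mulmxA (mulmxA V^T) V_orth mul1mx.
have expE (m : nat) (X : 'M[R]_m) (d : 'rV[R]_m) : X^T *m X = 1%:M ->
    expmx (- (t *: (X *m diag_mx d *m X^T))) =
    X *m diag_mx (\row_j expR (- (t * d 0 j))) *m X^T.
  move=> XX.
  have -> : - (t *: (X *m diag_mx d *m X^T)) = X *m diag_mx (- t *: d) *m X^T.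
    by rewrite -scaleNr linearZ /= -scalemxAr -scalemxAl.
  rewrite expmx_orthogonal_diag //; congr (_ *m diag_mx _ *m _).
  by apply/rowP => j; rewrite !mxE mulNr.
have PE : P = Q *m diag_mx (\row_j expR (- (t * a 0 j))) *m Q^T.
  by rewrite /P LE expE.
have PtE : Pt = W *m diag_mx (\row_j expR (- (t * b 0 j))) *m W^T.
  by rewrite /Pt LVE expE // /W trmx_mul !mulmxA.
have EE : E = Q *m diag_mx (\row_j (a 0 j)^-1) *m Q^T -
    W *m diag_mx (\row_j (b 0 j)^-1) *m W^T.
  rewrite /E /K {1}LE LVE !invmx_orthogonal_diag // /W trmx_mul !mulmxA.
  by [].
have diagT m l (X : 'M[R]_(m, l)) (d : 'rV[R]_l) :
    (X *m diag_mx d *m X^T)^T = X *m diag_mx d *m X^T.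
  by rewrite !trmx_mul trmxK tr_diag_mx mulmxA.
have [S [ev [SS ES]]] : exists (S : 'M[R]_n) (ev : 'rV[R]_n),
    S^T *m S = 1%:M /\ E = S *m diag_mx ev *m S^T.
  by apply: symmetric_spectral; rewrite EE linearB /= !diagT.
have [T [d [TT PT]]] : exists (T : 'M[R]_n) (d : 'rV[R]_n),
    T^T *m T = 1%:M /\ P - Pt = T *m diag_mx d *m T^T.
  by apply: symmetric_spectral; rewrite PE PtE linearB /= !diagT.
have dE l : d 0 l = (T^T *m (P - Pt) *m T) l l.
  by rewrite PT !mulmxA TT mul1mx -mulmxA TT mulmx1 mxE eqxx.
(* This choice maximises c s^2 subject to c^2 + s^2 = 1; then kappa = 1 / s^2 = 3/2, and kappa / (pi
   c') = 3 sqrt 3 / (2 pi). *)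
pose c' : R := (Num.sqrt 3)^-1; pose s : R := Num.sqrt (2 / 3).
have c0 : 0 < c' by rewrite invr_gt0 sqrtr_gt0.
have s0 : 0 < s by rewrite sqrtr_gt0 divr_gt0.
have s2 : s ^+ 2 = 2 / 3 by rewrite sqr_sqrtr // divr_ge0.
have cs1 : c' ^+ 2 + s ^+ 2 = 1.
  by rewrite s2 /c' exprVn sqr_sqrtr //; field.
rewrite EE in ES.
have main := weighted_exp_diff_le c0 s0 cs1 QQ SS TT WW a0 b0 ES.
(* [N] will be [nu2] or [nuS]; the factor 3/2 is the bound on the sums of [beta] and is absorbed
   into [c]. *)
have {}main (eta : 'I_n -> R) (N : R) : (forall beta : 'I_n -> 'I_n -> R,
      (forall l i, 0 <= beta l i) ->
      (forall l, \sum_i beta l i <= 3 / 2) -> (forall i, \sum_l beta l i <= 3 / 2) ->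
      \sum_l `|eta l| * (\sum_i `|ev 0 i| * beta l i) <= N * (3 / 2)) ->
    \sum_l eta l * d 0 l <= c * (N / t).
  rewrite s2 invf_div in main => HN; have := main eta t _ t_gt0 HN.
  rewrite -PE -PtE.
  under eq_bigr do rewrite -dE.
  move=> /le_trans; apply; rewrite le_eqVlt; apply/orP; left; apply/eqP.
  rewrite /c' /c; have := pi_gt0 R; have : 0 < Num.sqrt (3 : R) by rewrite sqrtr_gt0.
  move: (@pi R) (Num.sqrt 3) => q r r0 q0.
  by field; rewrite !gt_eqF.
have EV : E = S *m diag_mx ev *m S^T by rewrite EE.
split.
- rewrite PT spectral_norm_diag_le //.
  (* Reading the norm criterion at [nu2] itself yields |ev_i| <= nu2. *)
  have := lexx nu2; rewrite {1}/nu2 EV spectral_norm_diag_le // => /andP[nu0 /forallP Hev].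
  have c_ge0 : 0 <= c * (nu2 / t).
    by rewrite mulr_ge0 ?divr_ge0 ?mulr_ge0 ?sqrtr_ge0 ?pi_ge0 // ltW.
  rewrite c_ge0; apply/forallP => l0.
  (* [eta] is concentrated at [l0] with value 1 or -1, so only the row sum of [beta] at [l0]
     enters. *)
  have side (e : R) : `|e| = 1 -> e * d 0 l0 <= c * (nu2 / t).
    move=> e1; have := main (fun l => if l == l0 then e else 0) nu2.
    rewrite (bigD1 l0) //= eqxx big1 ?addr0; last first.
      by move=> l /negbTE->; rewrite mul0r.
    apply => beta b1 b2 b3; rewrite (bigD1 l0) //= eqxx [X in _ + X]big1 ?addr0; last first.
      by move=> l /negbTE->; rewrite normr0 mul0r.
    rewrite e1 mul1r; apply: (@le_trans _ _ (\sum_i nu2 * beta l0 i)).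
      by apply: ler_sum => i _; rewrite ler_wpM2r.
    by rewrite -mulr_sumr ler_wpM2l.
  rewrite ler_norml; apply/andP; split.
    by have := side (-1); rewrite normrN1 mulN1r lerNl; apply.
  by have := side 1; rewrite normr1 mul1r; apply.
- rewrite PT nuclear_norm_diag //.
  have -> : nuS = \sum_i `|ev 0 i| by rewrite /nuS EV nuclear_norm_diag.
  (* Here [eta] consists of the signs of [d]. *)
  have -> : \sum_i `|d 0 i| = \sum_i Num.sg (d 0 i) * d 0 i.
    by apply: eq_bigr => i _; rewrite normrEsg.
  apply: main => beta b1 b2 b3.
  apply: (@le_trans _ _ (\sum_l \sum_i `|ev 0 i| * beta l i)).
    apply: ler_sum => l _; rewrite ler_piMl ?normr_sg //.
      by apply: sumr_ge0 => i _; rewrite mulr_ge0.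
    by rewrite lern1; case: (_ != _).
  (* After the exchange it is the column sums of [beta], at fixed i, that are bounded by 3/2. *)
  rewrite exchange_big mulr_suml; apply: ler_sum => i _ /=.
  by rewrite -mulr_sumr ler_wpM2l.
Qed.
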